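(* For every positive integer $n$, $$\sum_{k=1}^n\left\{(k-1)^2\tan k+(2k-1)T(k)\right\}=n^2\,T(n),$$ where $T(m)=\sum_{j=1}^m\tan j$ for each positive integer $m$.
   Context: The tangent is evaluated at integers in radians. *)

(* Defs.v *)
From mathcomp Require Import all_boot all_order all_algebra.
From mathcomp Require Import reals trigo.

Set Implicit Arguments.
Unset Strict Implicit.
Unset Printing Implicit Defensive.

Import GRing.Theory Num.Theory.
Local Open Scope ring_scope.

Definition tan_sum (R : realType) (m : nat) : R :=
  \sum_(1 <= j < m.+1) tan (j%:R : R).

(* Main.v *)
Require Import Defs.
From mathcomp Require Import all_boot all_order all_algebra.
From mathcomp Require Import reals trigo.
From mathcomp Require Import ring.

Import GRing.Theory Num.Theory.
Local Open Scope ring_scope.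

(** The sum telescopes: as T(k-1) = T(k) - tan k, the k-th summand equals k^2 T(k) - (k-1)^2 T(k-1).
    The induction on [n] starts from the empty sum at 0. *)

Theorem proposition4p4 (R : realType) (n : nat) (hn : (0 < n)%N) :
  \sum_(1 <= k < n.+1)
     ((k%:R - 1) ^+ 2 * tan (k%:R : R) + (2 * k%:R - 1) * tan_sum R k)
  = n%:R ^+ 2 * tan_sum R n.
Proof.
clear hn; elim: n => [|n IHn].
  by rewrite big_geq // expr0n mul0r.
have tan_sumS : tan_sum R n.+1 = tan_sum R n + tan (n.+1%:R : R).
  by rewrite /tan_sum big_nat_recr.
rewrite big_nat_recr //= IHn tan_sumS.
(* What remains is the polynomial identity n^2 T + n^2 t + (2n+1)(T + t) = (n+1)^2 (T + t), with [t]
   = tan(n+1) and [T] = T(n) as indeterminates; [natr1] exposes [n.+1%:R] as n + 1 for [ring]. *)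
move: (tan _) (tan_sum _ _) => t T.
rewrite -natr1; ring.
Qed.
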